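(* Let $x$ be an indeterminate, $p,m,n$ positive integers with $p\ge m\ge n\ge\frac p2$, and $C_1,C_2\in\mathbb{Q}$. For $0\le k\le m$ put $U_k=C_1\big(H^{(1)}_{k+n}-H^{(1)}_{k+p-n-1}\big)+C_2\big(H^{(1)}_{k+m}-H^{(1)}_{k+p-m-1}\big)$, $V_k=C_1\big(H^{(2)}_{k+n}-H^{(2)}_{k+p-n-1}\big)+C_2\big(H^{(2)}_{k+m}-H^{(2)}_{k+p-m-1}\big)$; for $1\le k\le n$ put $a_k=\binom{m+k}{k}\binom{m}{k}\binom{n+k}{k}\binom{n}{k}$ and $h_k=H^{(1)}_{m+k}+H^{(1)}_{m-k}+H^{(1)}_{n+k}+H^{(1)}_{n-k}-4H^{(1)}_k$; for $n<k\le m$ put $b_k=\binom{m+k}{k}\binom{m}{k}\binom{n+k}{k}\big/\binom{k-1}{n}$. Then, as rational functions of $x$, \[ \frac{x\,(1-x)_n(1-x)_m}{(x)_{n+1}(x)_{m+1}}\left[C_1\sum_{s=p-n}^{n}\frac{1}{s-x}+C_2\sum_{s=p-m}^{m}\frac{1}{s-x}\right] = \frac{U_0}{x} + \sum_{k=1}^{n}a_k\left\{\frac{-k\,U_k}{(x+k)^2}+\frac{(1+k\,h_k)U_k-k\,V_k}{x+k}\right\} + \sum_{k=n+1}^{m}\frac{(-1)^{k-n}b_k\,U_k}{x+k}. \]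
   Context: $(a)_0=1$, $(a)_n=a(a+1)\cdots(a+n-1)$. Generalised harmonic sums: $H^{(i)}_n=\sum_{j=1}^n j^{-i}$ for $n\ge1$ and $H^{(i)}_0=0$.
   Formalization: When p = m, U_0 involves the undefined H_{-1} and the identity fails (e.g. p = m = n = 1, C_1 = 1, C_2 = 0: double pole at 0 on the left only), so it is assumed that C_1[n=p] + C_2[m=p] = 0, which is automatic for p > m. *)

(* Defs.v *)
From mathcomp Require Import all_boot all_order all_algebra.
Set Implicit Arguments.
Unset Strict Implicit.
Unset Printing Implicit Defensive.
Import GRing.Theory.
Local Open Scope ring_scope.

Definition ratfun := {fraction {poly rat}}.

Definition indet : ratfun := FracField.tofrac ('X : {poly rat}).

Definition ratfunC (c : rat) : ratfun := FracField.tofrac (c%:P : {poly rat}).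

Definition poch (R : nzRingType) (a : R) (n : nat) : R :=
  \prod_(i < n) (a + i%:R).

Definition harm (i n : nat) : rat := \sum_(1 <= j < n.+1) (j%:R ^+ i)^-1.

(* The index k + p - q - 1 is nonnegative unless k = 0 and p = q, when the
   truncated subtraction gives harm i 0 = 0 in place of the undefined H_{-1};
   see noHm1. *)
Definition harmdiff (i p q k : nat) : rat :=
  harm i (k + q) - harm i (k + p - q - 1).

Definition Uk (p m n : nat) (C1 C2 : rat) (k : nat) : rat :=
  C1 * harmdiff 1 p n k + C2 * harmdiff 1 p m k.

Definition Vk (p m n : nat) (C1 C2 : rat) (k : nat) : rat :=
  C1 * harmdiff 2 p n k + C2 * harmdiff 2 p m k.

Definition ak (m n k : nat) : rat :=
  ('C(m + k, k) * 'C(m, k) * 'C(n + k, k) * 'C(n, k))%:R.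

Definition hk (m n k : nat) : rat :=
  harm 1 (m + k) + harm 1 (m - k) + harm 1 (n + k) + harm 1 (n - k)
  - 4%:R * harm 1 k.

Definition bk (m n k : nat) : rat :=
  ('C(m + k, k) * 'C(m, k) * 'C(n + k, k))%:R / 'C(k.-1, n)%:R.

(* U_0 contains H_{-1} with coefficient - (C1 [n = p] + C2 [m = p]), so it has
   a meaning exactly when that coefficient vanishes.  This holds for all C1, C2
   when m < p.  When the coefficient is nonzero, 1 / (s - x) has a term s = 0
   that gives the left-hand side of the expansion a double pole at x = 0, which
   the right-hand side lacks. *)
Definition noHm1 (p m n : nat) (C1 C2 : rat) : Prop :=
  C1 * (n == p)%:R + C2 * (m == p)%:R = 0.

(* Main.v *)
Require Import Defs.
From mathcomp Require Import all_boot all_order all_algebra.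
From mathcomp Require Import ring zify.
Import GRing.Theory.
Local Open Scope ring_scope.

(* By [noHm1] the two sums over s combine into a single sum of w(s) / (s - x)
   over 1 <= s <= m, and U_k and V_k become the sums of w(s) / (s + k) and
   w(s) / (s + k)^2.  For each s the factor s - x cancels against (1 - x)_m, so
   the left-hand side is a proper fraction whose denominator is the product of
   x, the (x + k)^2 for 1 <= k <= n and the x + k for n < k <= m.  Its partial
   fraction numerators r_k are characterised by d_k | N - r_k D / d_k, which is
   checked by comparing values at x = -k and, at the double poles, logarithmic
   derivatives.  Multiplying by x (s - x), prime to d_k when k > 0, turns all
   the polynomials involved into products of Pochhammer symbols. *)


(** * Partial fractions over pairwise coprime denominators *)

Section CoprimePartialFractions.
Variable F : fieldType.
Implicit Types (N D : {poly F}).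

Lemma coprimep_prodr (I : Type) (s : seq I) (P : pred I) (d : I -> {poly F}) p :
  (forall i, P i -> coprimep p (d i)) -> coprimep p (\prod_(i <- s | P i) d i).
Proof.
move=> co; elim/big_ind: _ => // [|x y cx cy]; first exact: coprimep1.
by rewrite coprimepMr cx.
Qed.

Lemma prod_dvdp (I : eqType) (s : seq I) (d : I -> {poly F}) p :
  uniq s -> (forall i j, i != j -> coprimep (d i) (d j)) ->
  (forall i, d i %| p) -> \prod_(i <- s) d i %| p.
Proof.
move=> us co dp; elim: s us => [|i s IH] /=; first by rewrite big_nil dvd1p.
case/andP=> nis us; rewrite big_cons Gauss_dvdp ?dp ?IH //.
rewrite big_seq; apply: coprimep_prodr => j js; apply: co.
by apply: contraNneq nis => ->.
Qed.

(** For i != j, [d j] divides [D %/ d i], so every [d j] divides the difference of the two sides; by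
    coprimality [D] does too. The difference is smaller in size than [D], hence zero. *)
Lemma coprime_partial_fractions (I : finType) N (d r : I -> {poly F}) :
  let D : {poly F} := \prod_i d i in
  (forall i j, i != j -> coprimep (d i) (d j)) ->
  (forall i, size (r i) < size (d i))%N -> (size N < size D)%N ->
  (forall i, d i %| N - r i * (D %/ d i)) ->
  N = \sum_i r i * (D %/ d i).
Proof.
move=> D co szr szN dvd; apply/eqP; rewrite -subr_eq0.
have dn0 i : d i != 0 by rewrite -size_poly_gt0; apply: leq_trans (szr i).
have dD i : d i %| D by rewrite /D (bigD1 i) //= dvdp_mulr.
have DE i : D = D %/ d i * d i by rewrite divpK.
have Dn0 : D != 0 by apply/prodf_neq0.
have dW i j : j != i -> d j %| D %/ d i.
  by move=> nij; rewrite -(Gauss_dvdpl _ (co _ _ nij)) -DE.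
(* A nonzero difference would have size at least [size D] and at most the bound [szP], which forces
   [size D <= size N]. *)
apply: contraLR szN => nz; rewrite -leqNgt.
suff szP : (size (N - \sum_i r i * (D %/ d i))%R <= maxn (size N) (size D).-1)%N.
  have : D %| N - \sum_i r i * (D %/ d i).
    rewrite /D; apply: prod_dvdp => //; first exact: index_enum_uniq.
    move=> j; rewrite (bigD1 j) //= opprD addrA.
    apply: dvdp_sub; first exact: dvd.
    rewrite big_seq_cond; apply: (big_ind (fun q => d j %| q)) => [|x y|i /andP[_ nij]].
    - exact: dvdp0.
    - exact: dvdp_add.
    by apply/dvdp_mull/dW; rewrite eq_sym.
  move=> /(dvdp_leq nz) /leq_trans/(_ szP).
  by rewrite leq_max => /orP[//|]; rewrite leqNgt prednK ?leqnn // size_poly_gt0.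
apply: leq_trans (size_polyD _ _) _; rewrite geq_max leq_maxl /= size_polyN leq_max.
apply/orP; right; apply: leq_trans (size_sum _ _ _) _; apply/bigmax_leqP => i _.
apply: leq_trans (size_polyMleq _ _) _.
have Wn0 : D %/ d i != 0 by apply: contraNneq Dn0 => W0; rewrite (DE i) W0 mul0r.
have -> : size D = (size (D %/ d i) + size (d i)).-1 by rewrite -size_mul // -DE.
move: (szr i); set a := size (r i); set b := size (d i); set w := size (D %/ d i).
by lia.
Qed.

Lemma coprime_partial_fractions_tofrac (I : finType) N (d r : I -> {poly F}) :
  let D : {poly F} := \prod_i d i in
  (forall i j, i != j -> coprimep (d i) (d j)) ->
  (forall i, size (r i) < size (d i))%N -> (size N < size D)%N ->
  (forall i, d i %| N - r i * (D %/ d i)) ->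
  FracField.tofrac N / FracField.tofrac D
  = \sum_i FracField.tofrac (r i) / FracField.tofrac (d i).
Proof.
move=> D co szr szN dvd.
have dn0 i : d i != 0 by rewrite -size_poly_gt0; apply: leq_trans (szr i).
have Dn0 : D != 0 by apply/prodf_neq0.
rewrite (coprime_partial_fractions I N d r co szr szN dvd) rmorph_sum mulr_suml.
apply: eq_bigr => i _; rewrite rmorphM -/D /=.
have dD : d i %| D by rewrite /D (bigD1 i) //= dvdp_mulr.
have WE : FracField.tofrac D
    = FracField.tofrac (D %/ d i) * FracField.tofrac (d i).
  by rewrite -rmorphM /= divpK.
have Wt : FracField.tofrac (D %/ d i) != 0.
  by rewrite tofrac_eq0; apply: contraNneq Dn0 => W0; rewrite -(divpK dD) W0 mul0r.
by rewrite WE [X in _ / X]mulrC -mulf_div divff ?mulr1.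
Qed.

End CoprimePartialFractions.

(** * Divisibility by a square through logarithmic derivatives *)

Section LogDerivative.
Variable F : fieldType.
Implicit Types (P Q : {poly F}) (c u v : F).

(** States P'(c)/P(c) = v without division, so that the product rule holds with no condition that
    P(c) be nonzero. *)
Definition log_deriv P c v := P^`().[c] = P.[c] * v.

Lemma log_derivM P Q c u v :
  log_deriv P c u -> log_deriv Q c v -> log_deriv (P * Q) c (u + v).
Proof.
rewrite /log_deriv derivM hornerD !hornerM => -> ->; ring.
Qed.

Lemma dvdp_sqr_XsubC P c : P.[c] = 0 -> P^`().[c] = 0 -> ('X - c%:P) ^+ 2 %| P.
Proof.
move/polyXsubCP; rewrite dvdp_eq => /eqP PE; rewrite PE derivM derivXsubC.
rewrite hornerD !hornerM hornerC hornerXsubC subrr mulr0 add0r mulr1.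
by move/polyXsubCP => dv; rewrite expr2 dvdp_mul.
Qed.

(** Equal values and equal logarithmic derivatives give equal derivatives, so P - Q has a double
    root at c. *)
Lemma dvdp_sqr_log_deriv P Q c v : P.[c] = Q.[c] ->
  log_deriv P c v -> log_deriv Q c v -> ('X - c%:P) ^+ 2 %| P - Q.
Proof.
move=> E dP dQ; apply: dvdp_sqr_XsubC; rewrite ?derivB !hornerE.
  by rewrite E subrr.
by rewrite dP dQ E subrr.
Qed.

Lemma horner_poch P n c : (poch P n).[c] = poch P.[c] n.
Proof. by rewrite /poch horner_prod; apply: eq_bigr => i _; rewrite !hornerE hornerMn hornerC. Qed.

(** Each factor P + i has the constant derivative t and contributes t / (P(c) + i). *)
Lemma log_deriv_poch P n c t : P^`() = t%:P ->
  (forall i, (i < n)%N -> P.[c] + i%:R != 0) ->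
  log_deriv (poch P n) c (t * \sum_(i < n) (P.[c] + i%:R)^-1).
Proof.
move=> dP; elim: n => [|n IH] nz.
  by rewrite /log_deriv /poch !big_ord0 mulr0 mulr0 derivC horner0.
rewrite /poch !big_ord_recr /= [t * _]mulrDr; apply: log_derivM.
  by apply: IH => i lin; apply: nz; apply: ltnW.
have E : (P + n%:R).[c] = P.[c] + n%:R by rewrite hornerD -polyC_natr hornerC.
rewrite /log_deriv E derivD dP -polyC_natr derivC addr0 hornerC.
by rewrite mulrCA divff ?mulr1 //; apply: nz.
Qed.

End LogDerivative.

(** * Pochhammer symbols, factorials and harmonic sums *)

Lemma poch_add (R : nzRingType) (a : R) k l :
  poch a (k + l) = poch a k * poch (a + k%:R) l.
Proof.
rewrite /poch big_split_ord /=; congr (_ * _).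
by apply: eq_bigr => i _; rewrite natrD addrA.
Qed.

Lemma size_poch_linear (R : idomainType) (P : {poly R}) n :
  size P = 2 -> size (poch P n) = n.+1.
Proof.
move=> sP.
have szf i : size (P + i%:R) = 2.
  rewrite -polyC_natr size_polyDl // sP.
  by rewrite (leq_ltn_trans (size_polyC_leq1 _)).
elim: n => [|n IH]; first by rewrite /poch big_ord0 size_poly1.
rewrite -addn1 poch_add size_mul ?IH; last 2 first.
- by rewrite -size_poly_gt0 IH.
- by rewrite /poch big_ord1 addr0 -size_poly_gt0 szf.
by rewrite /poch big_ord1 addr0 szf; lia.
Qed.

Lemma poch_fact k n : poch (k.+1%:R : rat) n * k`!%:R = (n + k)`!%:R.
Proof.
elim: n => [|n IH]; first by rewrite /poch big_ord0 mul1r.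
rewrite /poch big_ord_recr /= mulrAC IH addSn factS -natrD -natrM.
by congr (_%:R); lia.
Qed.

Lemma poch_opp_fact k n : (n <= k)%N ->
  poch (- k%:R : rat) n * (k - n)`!%:R = (-1) ^+ n * k`!%:R.
Proof.
elim: n => [|n IH] lnk; first by rewrite /poch big_ord0 subn0.
rewrite exprS -mulrA -IH; last exact: ltnW.
rewrite /poch big_ord_recr /= -(subnSK lnk) factS natrM.
have -> : (k - n.+1).+1%:R = k%:R - n%:R :> rat by rewrite subnSK // natrB // ltnW.
ring.
Qed.

(** The left side is the value of (1 - x)_n at x = -k; this form exhibits the binomials of [ak], and
    its factorials cancel those of [pochX_cof_horner]. *)
Lemma poch_binomial n k : (k <= n)%N ->
  poch (k.+1%:R : rat) n = ('C(n + k, k) * 'C(n, k))%:R * (k`! * (n - k)`!)%:R.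
Proof.
move=> lkn; have fn0 : (k`!%:R : rat) != 0 by rewrite Num.Theory.pnatr_eq0 -lt0n fact_gt0.
apply: (mulIf fn0); rewrite poch_fact -!natrM -(bin_fact (leq_addl n k)).
by rewrite addnK -(bin_fact lkn); congr (_%:R); lia.
Qed.

Lemma harm_shift e q n :
  harm e (q + n) - harm e q = \sum_(i < n) ((q + i).+1%:R ^+ e)^-1.
Proof.
rewrite /harm (@big_cat_nat _ _ _ q.+1) ?ltnS ?leq_addr //= addrAC subrr add0r.
rewrite -{1}[q.+1]add0n big_addn subSS addnC addnK big_mkord.
by apply: eq_bigr => i _; rewrite addnS addnC.
Qed.


(** * Values and logarithmic derivatives of the Pochhammer factors at x = -k *)

(** For k <= n this is (x)_{n+1} with the factor x + k left out, so it does not vanish at x = -k. *)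
Definition pochX_cof (n k : nat) : {poly rat} :=
  poch 'X k * poch ('X + k.+1%:R) (n - k).

Lemma pochX_split n k : (k <= n)%N ->
  poch ('X : {poly rat}) n.+1 = ('X + k%:R) * pochX_cof n k.
Proof.
move=> lkn; have {1}-> : n.+1 = (k + (1 + (n - k)))%N by lia.
rewrite !poch_add /pochX_cof /poch big_ord1 addr0 mulrCA; congr (_ * (_ * _)).
by apply: eq_bigr => i _; congr (_ + _); rewrite -addrA natr1.
Qed.

Lemma horner_XDnat (k : nat) (c : rat) : ('X + k%:R).[c] = c + k%:R.
Proof. by rewrite hornerD hornerX -polyC_natr hornerC. Qed.

Lemma horner_1subX (c : rat) : (1 - 'X).[c] = 1 - c.
Proof. by rewrite !hornerE. Qed.

Lemma XDnat (k : nat) : 'X + k%:R = 'X - (- k%:R)%:P :> {poly rat}.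
Proof. by rewrite polyCN opprK polyC_natr. Qed.

(** The factors before x + k give (-k)_k = (-1)^k k!, those after it give (1)_{n-k} = (n-k)!. *)
Lemma pochX_cof_horner n k :
  (pochX_cof n k).[- k%:R] = (-1) ^+ k * (k`! * (n - k)`!)%:R.
Proof.
rewrite hornerM !horner_poch horner_XDnat hornerX.
have := poch_opp_fact k k (leqnn k); rewrite subnn mulr1 => ->.
have -> : - k%:R + k.+1%:R = 1 :> rat by rewrite -natr1; ring.
by have := poch_fact 0 (n - k); rewrite mulr1 addn0 => ->; rewrite natrM mulrA.
Qed.

Lemma log_deriv_pochX_cof n k :
  log_deriv _ (pochX_cof n k) (- k%:R) (harm 1 (n - k) - harm 1 k).
Proof.
rewrite addrC; apply: log_derivM.
  have -> : - harm 1 k = 1 * \sum_(i < k) (('X : {poly rat}).[- k%:R] + i%:R)^-1.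
    have := harm_shift 1 0 k; rewrite add0n [harm 1 0]/harm big_geq // subr0 => ->.
    (* The values -k + i run from -k to -1; reversing the order matches them with -1/j for j = 1,
       ..., k. *)
    rewrite mul1r -sumrN [RHS](reindex_inj rev_ord_inj) /=.
    apply: eq_bigr => i _; rewrite hornerX expr1 add0n natrB // -invrN.
    by congr (_^-1); ring.
  apply: log_deriv_poch => [|i lik]; first exact: derivX.
  by rewrite hornerX addrC subr_eq0 Num.Theory.eqr_nat neq_ltn lik.
have -> : harm 1 (n - k)
    = 1 * \sum_(i < n - k) (('X + k.+1%:R : {poly rat}).[- k%:R] + i%:R)^-1.
  have := harm_shift 1 0 (n - k); rewrite add0n [harm 1 0]/harm big_geq // subr0 => ->.
  rewrite mul1r; apply: eq_bigr => i _; rewrite expr1 add0n horner_XDnat.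
  by congr (_^-1); rewrite -!natr1; ring.
apply: log_deriv_poch => [|i _].
  by rewrite derivD derivX -polyC_natr derivC addr0.
rewrite horner_XDnat.
have -> : - k%:R + k.+1%:R + i%:R = i.+1%:R :> rat by rewrite -!natr1; ring.
by rewrite Num.Theory.pnatr_eq0.
Qed.

Lemma poch_1subX_horner n k : (poch (1 - 'X) n).[- k%:R] = poch (k.+1%:R : rat) n.
Proof. by rewrite horner_poch horner_1subX opprK -nat1r. Qed.

Lemma log_deriv_poch_1subX n k :
  log_deriv _ (poch (1 - 'X) n) (- k%:R : rat) (harm 1 k - harm 1 (n + k)).
Proof.
have -> : harm 1 k - harm 1 (n + k)
    = -1 * \sum_(i < n) ((1 - 'X : {poly rat}).[- k%:R] + i%:R)^-1.
  rewrite -opprB addnC harm_shift mulN1r; congr (- _).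
  apply: eq_bigr => i _; rewrite horner_1subX expr1 opprK.
  by congr (_^-1); rewrite -natr1 natrD; ring.
apply: log_deriv_poch => [|i _]; first by rewrite derivB derivX derivC sub0r polyCN.
by rewrite horner_1subX opprK nat1r -natrD Num.Theory.pnatr_eq0.
Qed.

(** * Denominators and numerators of the partial fractions *)

(* The pole at 0 is simple: the factor x of the left-hand side cancels one of the
   two factors x of (x)_{n+1} (x)_{m+1}. *)
Definition den (n k : nat) : {poly rat} := ('X + k%:R) ^+ ((0 < k <= n)%N).+1.

(* The numerator over [den n k] of the terms of the expansion with pole -k. *)
Definition resid (m n : nat) (U V : nat -> rat) (k : nat) : {poly rat} :=
  if k == 0%N then (U 0%N)%:P
  else if (k <= n)%N then
    ak m n k *: ((- k%:R * U k)%:P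
                 + ((1 + k%:R * hk m n k) * U k - k%:R * V k)%:P * ('X + k%:R))
  else ((-1) ^+ (k - n) * bk m n k * U k)%:P.

(** The division is exact for 1 <= s <= m, since s - x is then a factor of (1 - x)_m. *)
Definition numer (m n s : nat) : {poly rat} :=
  poch (1 - 'X) n * poch (1 - 'X) m %/ (s%:R - 'X).

(** One factor x + k taken from each [den n k] makes up (x)_{m+1}; what remains is (x)_{n+1} without
    its factor x. *)
Lemma mul_X_prod_den m n : (n <= m)%N ->
  'X * \prod_(k < m.+1) den n k = poch 'X n.+1 * poch 'X m.+1.
Proof.
move=> lnm; rewrite mulrC [RHS]mulrC /den.
under eq_bigr do rewrite exprS.
rewrite big_split /= -mulrA; congr (_ * _).
rewrite big_ord_recl expr0 mul1r /poch big_ord_recl addr0 mulrC; congr (_ * _).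
rewrite (big_ord_widen m (fun i => 'X + i.+1%:R)) // [RHS]big_mkcond.
by apply: eq_bigr => i _; rewrite /= /bump; case: ifP.
Qed.

Lemma numerK m n s : (0 < s <= m)%N ->
  numer m n s * (s%:R - 'X) = poch (1 - 'X) n * poch (1 - 'X) m.
Proof.
case/andP=> s0 sm; rewrite divpK // dvdp_mull //.
have lt : (s.-1 < m)%N by lia.
rewrite /poch (bigD1 (Ordinal lt)) //= dvdp_mulr //.
suff -> : 1 - 'X + s.-1%:R = s%:R - 'X :> {poly rat} by [].
by rewrite -[in RHS](prednK s0) -nat1r; ring.
Qed.

Lemma den_neq0 n k : den n k != 0.
Proof. by rewrite expf_neq0 // XDnat polyXsubC_eq0. Qed.

Lemma size_den n k : size (den n k) = ((0 < k <= n)%N).+2.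
Proof. by rewrite /den XDnat size_exp_XsubC. Qed.

Lemma coprime_den n j k : j != k -> coprimep (den n j) (den n k).
Proof.
move=> njk; rewrite coprimep_expl // coprimep_expr // !XDnat coprimep_XsubC2 //.
by rewrite opprK addrC subr_eq0 Num.Theory.eqr_nat.
Qed.

(** * The divisibility conditions at the poles, for a single s *)

(** Both products have the same value and the same logarithmic derivative at x = -k. Agreement of
    the latter is what determines the coefficient of 1/(x+k), and in particular [hk]. *)
Lemma dvdp_numer_double m n k s :
  let u := (s%:R + k%:R)^-1 : rat in
  (0 < k <= n)%N -> (n <= m)%N -> (0 < s)%N ->
  ('X + k%:R) ^+ 2 %|
    'X * (poch (1 - 'X) n * poch (1 - 'X) m)
    - ak m n k *: ((- k%:R * u)%:P
                   + ((1 + k%:R * hk m n k) * u - k%:R * u ^+ 2)%:P * ('X + k%:R))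
      * (pochX_cof n k * pochX_cof m k) * (s%:R - 'X).
Proof.
move=> u /andP[k0 kn] nm s0.
have lkm := leq_trans kn nm.
have knz : (k%:R : rat) != 0 by rewrite Num.Theory.pnatr_eq0 -lt0n.
have skn : (s%:R + k%:R : rat) != 0.
  by rewrite -natrD Num.Theory.pnatr_eq0 addn_eq0 negb_and -lt0n s0.
rewrite XDnat.
have sX : (s%:R - 'X : {poly rat}).[- k%:R] = s%:R + k%:R.
  by rewrite hornerD hornerN hornerX -polyC_natr hornerC opprK.
move: (pochX_cof_horner n k) (log_deriv_pochX_cof n k).
move: (pochX_cof_horner m k) (log_deriv_pochX_cof m k).
move: (pochX_cof n k) (pochX_cof m k) => cn cm vm dm vn dn.
(* The common logarithmic derivative, read off from the factors x, (1 - x)_n and (1 - x)_m. *)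
apply: (@dvdp_sqr_log_deriv _ _ _ _
  (- k%:R^-1 + ((harm 1 k - harm 1 (n + k)) + (harm 1 k - harm 1 (m + k))))).
- rewrite !hornerM sX hornerX !poch_1subX_horner !poch_binomial //.
  rewrite vn vm hornerZ hornerD hornerC hornerM hornerXsubC subrr mulr0 addr0.
  rewrite /ak /u !natrM.
  have e1 : ((-1) ^+ k * (-1) ^+ k : rat) = 1 by rewrite -expr2 sqrr_sign.
  (* The two signs (-1)^k multiply to 1, and u cancels the value s + k of s - x. *)
  transitivity ((- k%:R) * ('C(n + k, k)%:R * 'C(n, k)%:R * (k`!%:R * (n - k)`!%:R) *
    ('C(m + k, k)%:R * 'C(m, k)%:R * (k`!%:R * (m - k)`!%:R)))
    * ((-1) ^+ k * (-1) ^+ k) * ((s%:R + k%:R)^-1 * (s%:R + k%:R)) : rat).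
    by rewrite e1 mulVf // !mulr1.
  ring.
- apply: log_derivM.
    by rewrite /log_deriv derivX hornerC hornerX mulrNN divff.
  apply: log_derivM; exact: log_deriv_poch_1subX.
(* Split along the other product: the linear numerator gives -1/k - h_k + u, the cofactors give
   differences of harmonic sums, and s - x gives -u. *)
have -> : - k%:R^-1 + (harm 1 k - harm 1 (n + k) + (harm 1 k - harm 1 (m + k)))
  = (- k%:R^-1 - hk m n k + u) + ((harm 1 (n - k) - harm 1 k) + (harm 1 (m - k) - harm 1 k)) + - u.
  by rewrite /hk; ring.
apply: log_derivM; last first.
  by rewrite /log_deriv sX derivB derivX -polyC_natr derivC sub0r hornerN hornerC mulrN mulfV.
apply: log_derivM; last exact: log_derivM.
rewrite /log_deriv derivZ !hornerZ derivD derivM !derivC derivXsubC mul0r !add0r mulr1.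
rewrite hornerD !hornerM !hornerC hornerXsubC subrr mulr0 addr0 /u.
field.
by rewrite skn knz.
Qed.


(** At a simple pole it is enough to compare values. Since k > n, (x)_{n+1} does not vanish at
    -k. *)
Lemma dvdp_numer_simple m n k s : (n < k <= m)%N -> (0 < s)%N ->
  'X + k%:R %|
    'X * (poch (1 - 'X) n * poch (1 - 'X) m)
    - ((-1) ^+ (k - n) * bk m n k * (s%:R + k%:R)^-1)%:P
      * (poch 'X n.+1 * pochX_cof m k) * (s%:R - 'X).
Proof.
move=> /andP[nk km] s0.
have skn : (s%:R + k%:R : rat) != 0.
  by rewrite -natrD Num.Theory.pnatr_eq0 addn_eq0 negb_and -lt0n s0.
have sX : (s%:R - 'X : {poly rat}).[- k%:R] = s%:R + k%:R.
  by rewrite hornerD hornerN hornerX -polyC_natr hornerC opprK.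
move: (pochX_cof_horner m k); move: (pochX_cof m k) => cm vm.
have fact_neq0 j : (j`!%:R : rat) != 0 by rewrite Num.Theory.pnatr_eq0 -lt0n fact_gt0.
have k0 : (0 < k)%N by apply: leq_ltn_trans nk.
have lenk : (n <= k.-1)%N by lia.
have binn0 : ('C(k.-1, n)%:R : rat) != 0 by rewrite Num.Theory.pnatr_eq0 -lt0n bin_gt0.
have En : poch (k.+1%:R : rat) n = 'C(n + k, k)%:R * n`!%:R.
  apply: (mulIf (fact_neq0 k)); rewrite poch_fact -!natrM -(bin_fact (leq_addl n k)) addnK.
  by congr (_%:R); lia.
(* This value is the source of the divisor ['C(k.-1, n)] in [bk] and of the (-1)^n in the sign. *)
have Xn : poch (- k%:R : rat) n.+1 = (-1) ^+ n.+1 * (k%:R * 'C(k.-1, n)%:R * n`!%:R).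
  apply: (mulIf (fact_neq0 (k - n.+1)%N)); rewrite poch_opp_fact //.
  rewrite -[in LHS](prednK k0) factS -(bin_fact lenk) prednK //.
  have -> : (k.-1 - n = k - n.+1)%N by lia.
  by rewrite !natrM !mulrA.
rewrite XDnat dvdp_XsubCl; apply/eqP.
rewrite hornerD hornerN !hornerM sX hornerX !poch_1subX_horner En poch_binomial //.
rewrite horner_poch hornerX Xn vm hornerC /bk !natrM.
have -> : (-1) ^+ k = (-1) ^+ (k - n) * (-1) ^+ n :> rat by rewrite -exprD subnK // ltnW.
have e1 : ((-1) ^+ n * (-1) ^+ n : rat) = 1 by rewrite -expr2 sqrr_sign.
have e2 : ((-1) ^+ (k - n) * (-1) ^+ (k - n) : rat) = 1 by rewrite -expr2 sqrr_sign.
rewrite exprS.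
move: ((-1) ^+ (k - n)) ((-1) ^+ n) e1 e2 => a b bb aa.
apply/eqP; rewrite subr_eq0; apply/eqP.
transitivity ((- k%:R) *
  ('C(n + k, k)%:R * n`!%:R * ('C(m + k, k)%:R * 'C(m, k)%:R * (k`!%:R * (m - k)`!%:R)))
   * (a * a) * (b * b)); first by rewrite aa bb !mulr1.
by field; rewrite skn binn0.
Qed.

(** At x = 0 both products equal n! m!, as s^-1 cancels the value of s - x. *)
Lemma dvdp_numer0 m n s : (0 < s)%N ->
  'X %| poch (1 - 'X) n * poch (1 - 'X) m
        - (s%:R^-1 : rat)%:P * (pochX_cof n 0 * pochX_cof m 0) * (s%:R - 'X).
Proof.
move=> s0; have sn0 : (s%:R : rat) != 0 by rewrite Num.Theory.pnatr_eq0 -lt0n.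
have := pochX_cof_horner m 0; have := pochX_cof_horner n 0; rewrite oppr0.
move: (pochX_cof m 0) (pochX_cof n 0) => cm cn; rewrite !subn0 !mul1r !mul1n => vn vm.
have -> p : ('X %| p) = root p (0 : rat) by rewrite -dvdp_XsubCl polyC0 subr0.
apply/eqP; rewrite hornerD hornerN !hornerM vn vm hornerC.
have poch1 j : (poch (1 - 'X) j).[0] = j`!%:R :> rat.
  have := poch_1subX_horner j 0; rewrite oppr0 => ->.
  by have := poch_fact 0 j; rewrite mulr1 addn0.
rewrite !poch1 hornerD hornerN hornerX subr0 -polyC_natr hornerC.
by rewrite mulrAC mulVf // mul1r subrr.
Qed.

Lemma den_dvdp m n k : (k <= m)%N -> den n k %| \prod_(j < m.+1) den n j.
Proof.
by rewrite -ltnS => lkm; rewrite (bigD1 (Ordinal lkm)) //= dvdp_mulr.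
Qed.

Lemma coprime_den_sX n k s : (0 < s)%N -> coprimep (den n k) (s%:R - 'X).
Proof.
move=> s0; rewrite /den XDnat coprimep_expl // coprimep_sym coprimep_XsubC /root.
rewrite hornerD hornerN hornerX -polyC_natr hornerC opprK -natrD.
by rewrite Num.Theory.pnatr_eq0 addn_eq0 negb_and -lt0n s0.
Qed.

(** U and V are here the contributions of one s. Multiplying by s - x, prime to [den n k], restores
    the full product (1 - x)_n (1 - x)_m; for k > 0 a further factor x turns the quotient [W] into
    known Pochhammer products. *)
Lemma dvdp_numer_resid m n k s : (n <= m)%N -> (k <= m)%N -> (0 < s <= m)%N ->
  den n k %| numer m n s
    - resid m n (fun k => (s%:R + k%:R)^-1) (fun k => (s%:R + k%:R)^-1 ^+ 2) k
      * (\prod_(j < m.+1) den n j %/ den n k).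
Proof.
move=> nm km sm; have s0 : (0 < s)%N by case/andP: sm.
rewrite -(Gauss_dvdpl _ (coprime_den_sX n k s s0)) mulrBl numerK //.
have XW : 'X * (\prod_(j < m.+1) den n j %/ den n k) * den n k
          = poch 'X n.+1 * poch 'X m.+1.
  by rewrite -mulrA divpK ?den_dvdp // mul_X_prod_den.
move: (_ %/ _) XW => W XW.
(* For k = 0 the denominator is x itself, so no factor x may be introduced; [W] is found by
   cancelling x twice. *)
have [k0|kn0] := eqVneq k 0%N.
  rewrite k0 in XW *; rewrite /resid eqxx addr0 {1}/den expr1 addr0.
  have X0 : 'X != 0 :> {poly rat} by rewrite polyX_eq0.
  have -> : W = pochX_cof n 0 * pochX_cof m 0.
    apply: (mulIf X0); apply: (mulfI X0).
    move: XW; rewrite /den expr1 !addr0 (pochX_split n 0) // (pochX_split m 0) // addr0.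
    by move=> E; rewrite mulrA E; ring.
  exact: dvdp_numer0.
have cX : coprimep (den n k) 'X.
  rewrite /den coprimep_expl //; have := coprimep_XsubC ('X + k%:R : {poly rat}) 0.
  by rewrite polyC0 subr0 => ->; rewrite /root horner_XDnat add0r Num.Theory.pnatr_eq0.
rewrite -(Gauss_dvdpr _ cX) mulrBr.
have k0 : (0 < k)%N by rewrite lt0n.
have [kn|nk] := leqP k n.
  have -> : 'X * (resid m n (fun k => (s%:R + k%:R)^-1) (fun k => (s%:R + k%:R)^-1 ^+ 2) k * W * (s%:R - 'X))
     = ak m n k *: ((- k%:R * (s%:R + k%:R)^-1)%:P
          + ((1 + k%:R * hk m n k) * (s%:R + k%:R)^-1 - k%:R * (s%:R + k%:R)^-1 ^+ 2)%:P * ('X + k%:R))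
      * (pochX_cof n k * pochX_cof m k) * (s%:R - 'X).
    have <- : 'X * W = pochX_cof n k * pochX_cof m k.
      apply: (mulIf (den_neq0 n k)); rewrite XW (pochX_split n k) // (pochX_split m k) //.
      by rewrite /den k0 kn expr2; ring.
    by rewrite /resid (negPf kn0) kn; ring.
  by rewrite {1}/den k0 kn; apply: dvdp_numer_double; rewrite ?k0.
have -> : 'X * (resid m n (fun k => (s%:R + k%:R)^-1) (fun k => (s%:R + k%:R)^-1 ^+ 2) k * W * (s%:R - 'X))
     = ((-1) ^+ (k - n) * bk m n k * (s%:R + k%:R)^-1)%:P
      * (poch 'X n.+1 * pochX_cof m k) * (s%:R - 'X).
  have <- : 'X * W = poch 'X n.+1 * pochX_cof m k.
    apply: (mulIf (den_neq0 n k)); rewrite XW (pochX_split m k) //.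
    by rewrite /den k0 leqNgt nk /= expr1; ring.
  by rewrite /resid (negPf kn0) leqNgt nk /=; ring.
have -> : den n k = 'X + k%:R by rewrite /den k0 leqNgt nk /= expr1.
by apply: dvdp_numer_simple; rewrite ?nk.
Qed.


(** * Harmonic differences as weighted sums over s *)

(* For k = 0 and p = q the sum has a term s = 0, which is 0 since 0^-1 = 0; this
   agrees with the truncated index in [harmdiff]. *)
Lemma harmdiff_sum e p q k : (0 < e)%N -> (q <= p)%N -> (p <= 2 * q)%N ->
  harmdiff e p q k = \sum_(p - q <= s < q.+1) ((s%:R + k%:R) ^+ e)^-1.
Proof.
move=> e0 qp pq; rewrite /harmdiff.
have [/eqP|a0] := posnP (k + (p - q))%N.
  rewrite addn_eq0 => /andP[/eqP -> /eqP pq0]; 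
  have -> : (0 + p - q - 1 = 0)%N by lia.
  rewrite pq0 add0n.
  rewrite [harm e 0]/harm [X in _ - X]big_geq // subr0.
  rewrite big_ltn // addr0 expr0n eqn0Ngt e0 invr0 add0r.
  by apply: eq_bigr => s _; rewrite addr0.
(* Now k + p - q > 0, so no truncation occurs, and the difference is a block of 2q + 1 - p
   consecutive terms. *)
have -> : (k + p - q - 1 = (k + (p - q)).-1)%N by lia.
have {1}-> : (k + q = (k + (p - q)).-1 + (q.+1 - (p - q)))%N by lia.
rewrite harm_shift -[X in \sum_(X <= _ < _) _]add0n big_addn big_mkord.
by apply: eq_bigr => s _; rewrite -natrD; congr ((_%:R ^+ _)^-1); lia.
Qed.

Definition weight (p m n : nat) (C1 C2 : rat) (s : nat) : rat :=
  C1 * (p - n <= s <= n)%N%:R + C2 * (p - m <= s <= m)%N%:R.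

(** The weight at s = 0 is C1 [n = p] + C2 [m = p], which [noHm1] makes zero, so the sum may start
    at 1. The morphism [phi] lets one identity serve both the rational U_k, V_k and the sums of
    rational functions. *)
Lemma weighted_sum (K : comNzRingType) (phi : {rmorphism rat -> K}) p m n C1 C2
    (f : nat -> K) : (m <= p)%N -> (n <= m)%N -> noHm1 p m n C1 C2 ->
  phi C1 * \sum_(p - n <= s < n.+1) f s + phi C2 * \sum_(p - m <= s < m.+1) f s
  = \sum_(1 <= s < m.+1) phi (weight p m n C1 C2 s) * f s.
Proof.
move=> mp nm hdef.
have w0 : weight p m n C1 C2 0 = 0.
  rewrite -hdef /weight !leq0n !andbT !leqn0 !subn_eq0.
  by rewrite [in RHS]eqn_leq (leq_trans nm mp) [m == p]eqn_leq mp.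
have E q : (q <= m)%N -> \sum_(p - q <= s < q.+1) f s
    = \sum_(0 <= s < m.+1) phi (p - q <= s <= q)%N%:R * f s.
  move=> qm; rewrite (big_nat_widenl _ 0%N) // (big_nat_widen _ _ m.+1) //.
  rewrite [LHS]big_mkcond; apply: eq_bigr => s _ /=; rewrite rmorph_nat ltnS.
  by case: ifP => _; rewrite ?mul1r ?mul0r.
have -> : \sum_(1 <= s < m.+1) phi (weight p m n C1 C2 s) * f s
    = \sum_(0 <= s < m.+1) phi (weight p m n C1 C2 s) * f s.
  by rewrite [RHS]big_ltn // w0 rmorph0 mul0r add0r.
rewrite !E // !mulr_sumr -big_split /=; apply: eq_bigr => s _.
by rewrite /weight rmorphD !rmorphM mulrDl !mulrA.
Qed.

(** * Linearity in the weights, size bounds and the expansion *)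

Lemma size_1subX : size (1 - 'X : {poly rat}) = 2.
Proof. by rewrite -size_polyN opprB -polyC1 size_XsubC. Qed.

(** The numerators are linear in the pair (U, V), which reduces the divisibility conditions to a
    single s. *)
Lemma resid_sum m n k a b (w : nat -> rat) (U V : nat -> nat -> rat) :
  resid m n (fun k => \sum_(a <= s < b) w s * U s k)
            (fun k => \sum_(a <= s < b) w s * V s k) k
  = \sum_(a <= s < b) w s *: resid m n (U s) (V s) k.
Proof.
rewrite /resid; case: ifP => _.
  rewrite rmorph_sum; apply: eq_bigr => s _.
  by rewrite /= polyCM mul_polyC.
case: ifP => _; last first.
  rewrite mulr_sumr rmorph_sum; apply: eq_bigr => s _.
  by rewrite /= -mul_polyC -polyCM; congr (_%:P); ring.
rewrite !mulr_sumr -sumrB !rmorph_sum mulr_suml -big_split /= scaler_sumr.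
apply: eq_bigr => s _; rewrite /= -!mul_polyC.
rewrite !(polyCM, polyCD, polyCB, polyCN); ring.
Qed.

Lemma size_resid m n U V k : (size (resid m n U V k) < size (den n k))%N.
Proof.
rewrite size_den /resid; case: posnP => [_|k0].
  exact: size_polyC_leq1.
case: (leqP k n) => kn; last exact: size_polyC_leq1.
rewrite ltnS; apply: leq_trans (size_scale_leq _ _) _.
apply: leq_trans (size_polyD _ _) _; rewrite geq_max.
rewrite (leq_trans (size_polyC_leq1 _)) //= mul_polyC.
by apply: leq_trans (size_scale_leq _ _) _; rewrite XDnat size_XsubC.
Qed.

Lemma size_prod_den m n : (n <= m)%N ->
  size (\prod_(k < m.+1) den n k) = (n + m).+2.
Proof.
move=> nm; have D0 : \prod_(k < m.+1) den n k != 0.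
  by apply/prodf_neq0 => k _; apply: den_neq0.
have szX j : size (poch ('X : {poly rat}) j) = j.+1.
  by apply: size_poch_linear; rewrite size_polyX.
have := congr1 (fun p : {poly rat} => size p) (mul_X_prod_den m n nm).
rewrite mulrC size_mulX // size_mul -?size_poly_gt0 ?szX // => -[->].
lia.
Qed.

Lemma size_numer m n s : (0 < s <= m)%N -> (size (numer m n s) <= n + m)%N.
Proof.
move=> sm; have := congr1 (fun p : {poly rat} => size p) (numerK m n s sm).
have sz j : size (poch (1 - 'X : {poly rat}) j) = j.+1.
  exact/size_poch_linear/size_1subX.
have szs : size (s%:R - 'X : {poly rat}) = 2.
  by rewrite -size_polyN opprB -polyC_natr size_XsubC.
have [->|N0] := eqVneq (numer m n s) 0; first by rewrite size_poly0.
rewrite !size_mul -?size_poly_gt0 ?szs ?sz // ?size_poly_gt0 //.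
by rewrite addn2 addSn addnS => -[->].
Qed.

Lemma tofrac_poch (p : {poly rat}) n :
  FracField.tofrac (poch p n) = poch (FracField.tofrac p) n.
Proof.
by rewrite rmorph_prod; apply: eq_bigr => i _; rewrite rmorphD rmorph_nat.
Qed.

Lemma tofrac_expansion m n (w : nat -> rat) : (n <= m)%N ->
  let N := \sum_(1 <= s < m.+1) w s *: numer m n s in
  let U k := \sum_(1 <= s < m.+1) w s * (s%:R + k%:R)^-1 in
  let V k := \sum_(1 <= s < m.+1) w s * (s%:R + k%:R)^-1 ^+ 2 in
  FracField.tofrac N / FracField.tofrac (\prod_(k < m.+1) den n k)
  = \sum_(k < m.+1) FracField.tofrac (resid m n U V k) / FracField.tofrac (den n k).
Proof.
move=> nm N U V.
apply: (coprime_partial_fractions_tofrac _ _ N (fun k : 'I_m.+1 => den n k)).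
- by move=> i j nij; apply: coprime_den.
- by move=> i; apply: size_resid.
- rewrite size_prod_den // ltnS leqW //.
  rewrite /N big_nat; apply: leq_trans (size_sum _ _ _) _; apply/bigmax_leqP_seq => s _ hs.
  by apply: leq_trans (size_scale_leq _ _) _; apply: size_numer.
move=> k; rewrite /N resid_sum mulr_suml -sumrB big_nat.
apply: (big_ind (fun q => den n k %| q)) => [|x y|s hs]; first exact: dvdp0.
  exact: dvdp_add.
rewrite -scalerAl -scalerBr -mul_polyC; apply/dvdp_mull/dvdp_numer_resid => //.
by rewrite -ltnS.
Qed.


(** * Translation to rational functions and conclusion *)

Lemma addf_div_sqr (K : fieldType) (a b c d : K) : d != 0 ->
  a * (b + c * d) / d ^+ 2 = a * (b / d ^+ 2 + c / d).
Proof. by move=> d0; field. Qed.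

Lemma tofrac_numer m n s : (0 < s <= m)%N ->
  poch (1 - indet) n * poch (1 - indet) m * (s%:R - indet)^-1
  = FracField.tofrac (numer m n s).
Proof.
move=> sm; have <- : FracField.tofrac (1 - 'X) = 1 - indet.
  by rewrite rmorphB rmorph1.
rewrite -!tofrac_poch -rmorphM -(numerK m n s sm) rmorphM /=.
have E : FracField.tofrac (s%:R - 'X : {poly rat}) = s%:R - indet.
  by rewrite rmorphB rmorph_nat.
rewrite E mulfK // -E tofrac_eq0 -size_poly_eq0 -size_polyN opprB.
by rewrite -polyC_natr size_XsubC.
Qed.

Lemma tofrac_den n k :
  FracField.tofrac (den n k) = (indet + k%:R) ^+ ((0 < k <= n)%N).+1.
Proof. by rewrite rmorphXn rmorphD rmorph_nat. Qed.

Lemma indetD_neq0 k : indet + k%:R != 0.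
Proof.
have -> : indet + k%:R = FracField.tofrac ('X + k%:R) by rewrite rmorphD rmorph_nat.
by rewrite tofrac_eq0 XDnat polyXsubC_eq0.
Qed.

Lemma sum_tofrac_resid m n (U V : nat -> rat) : (n <= m)%N ->
  \sum_(k < m.+1) FracField.tofrac (resid m n U V k) / FracField.tofrac (den n k)
  = ratfunC (U 0%N) / indet
    + \sum_(1 <= k < n.+1)
        ratfunC (ak m n k)
        * (ratfunC (- k%:R * U k) / (indet + k%:R) ^+ 2
           + ratfunC ((1 + k%:R * hk m n k) * U k - k%:R * V k) / (indet + k%:R))
    + \sum_(n.+1 <= k < m.+1)
        ratfunC ((-1) ^+ (k - n) * bk m n k * U k) / (indet + k%:R).
Proof.
move=> nm.
rewrite -(big_mkord xpredT (fun k => FracField.tofrac (resid m n U V k) / FracField.tofrac (den n k))).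
rewrite big_ltn // (@big_cat_nat _ _ _ n.+1) //= addrA; congr (_ + _ + _).
- by rewrite tofrac_den /resid eqxx expr1 addr0.
- rewrite !big_nat; apply: eq_bigr => k /andP[k0 kn]; rewrite ltnS in kn.
  rewrite tofrac_den k0 kn /resid eqn0Ngt k0 kn -addf_div_sqr ?indetD_neq0 //.
  have <- : FracField.tofrac ('X + k%:R) = indet + k%:R by rewrite rmorphD rmorph_nat.
  by rewrite -mul_polyC tofracM tofracD tofracM.
rewrite !big_nat; apply: eq_bigr => k /andP[nk _].
have k0 : (0 < k)%N by apply: leq_ltn_trans nk.
by rewrite tofrac_den /resid eqn0Ngt k0 leqNgt nk /= expr1.
Qed.

Theorem theorem3p3 (p m n : nat) (C1 C2 : rat)
  (hp : (0 < p)%N) (hm : (0 < m)%N) (hn : (0 < n)%N)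
  (hmp : (m <= p)%N) (hnm : (n <= m)%N) (hpn : (p <= 2 * n)%N)
  (hdef : noHm1 p m n C1 C2) :
  let x := indet in
  let U := Uk p m n C1 C2 in
  let V := Vk p m n C1 C2 in
  x * poch (1 - x) n * poch (1 - x) m / (poch x n.+1 * poch x m.+1)
    * (ratfunC C1 * \sum_(p - n <= s < n.+1) (s%:R - x)^-1
       + ratfunC C2 * \sum_(p - m <= s < m.+1) (s%:R - x)^-1)
  = ratfunC (U 0%N) / x
    + \sum_(1 <= k < n.+1)
        ratfunC (ak m n k)
        * (ratfunC (- k%:R * U k) / (x + k%:R) ^+ 2
           + ratfunC ((1 + k%:R * hk m n k) * U k - k%:R * V k) / (x + k%:R))
    + \sum_(n.+1 <= k < m.+1)
        ratfunC ((-1) ^+ (k - n) * bk m n k * U k) / (x + k%:R).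
Proof.
move=> x U V; rewrite -(sum_tofrac_resid m n U V hnm).
pose w := weight p m n C1 C2.
have hm2 : (p <= 2 * m)%N by lia.
(* The exponent e = 1 gives U and e = 2 gives V. *)
have harm_weight e k : (0 < e)%N ->
    C1 * harmdiff e p n k + C2 * harmdiff e p m k
    = \sum_(1 <= s < m.+1) w s * ((s%:R + k%:R) ^+ e)^-1.
  move=> e0; rewrite !harmdiff_sum // ?(leq_trans hnm) //.
  exact: (weighted_sum rat idfun).
have UE k : U k = \sum_(1 <= s < m.+1) w s * (s%:R + k%:R)^-1.
  exact: harm_weight.
have VE k : V k = \sum_(1 <= s < m.+1) w s * (s%:R + k%:R)^-1 ^+ 2.
  rewrite /V /Vk harm_weight //; apply: eq_bigr => s _.
  by rewrite exprVn.
(* [resid] evaluates U and V only at 0 and k, so pointwise equalities suffice. *)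
have resE k : resid m n U V k = resid m n
    (fun k => \sum_(1 <= s < m.+1) w s * (s%:R + k%:R)^-1)
    (fun k => \sum_(1 <= s < m.+1) w s * (s%:R + k%:R)^-1 ^+ 2) k.
  by rewrite /resid !UE !VE.
under [RHS]eq_bigr do rewrite resE.
rewrite -tofrac_expansion //.
have -> := weighted_sum ratfun (@FracField.tofrac {poly rat} \o polyC) p m n C1 C2
  (fun s => (s%:R - x)^-1) hmp hnm hdef.
have pochE j : poch x j = FracField.tofrac (poch 'X j) by rewrite tofrac_poch.
rewrite !pochE -rmorphM -mul_X_prod_den // rmorphM -/x.
have x0 : x != 0 by rewrite tofrac_eq0 polyX_eq0.
(* The leading x cancels the surplus x of (x)_{n+1} (x)_{m+1} over the product of the [den n k]. *)
rewrite -(mulrA x) -mulf_div divff // mul1r mulrAC; congr (_ / _).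
rewrite rmorph_sum mulr_sumr !big_nat; apply: eq_bigr => s sm.
by rewrite mulrCA tofrac_numer // -mul_polyC rmorphM.
Qed.
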